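(* For every integer $m\geq 3$ there exists a polynomial system of the form $$(\star)\qquad \begin{cases} \alpha_1+\alpha_2x^{a_2}y^{b_2}+\alpha_3x^{a_3}y^{b_3}=0\\ \beta_1 + \beta_2 x^{c_2}y^{d_2} + \cdots +\beta_m x^{c_m} y^{d_m}=0,\end{cases}$$ with all $\alpha_i$ and $\beta_i$ nonzero real numbers and $(a_2,b_2),(a_3,b_3),(c_2,d_2),\ldots,(c_m,d_m)$ distinct nonzero vectors, having at least $2m-1$ roots $(x,y)$ in the positive quadrant $\mathbb{R}^2_+$. In particular (for $m=4$), the polynomial system $$x^6+\tfrac{44}{31}y^3-y=0,\qquad y^{14}+\tfrac{44}{31}x^3y^8-xy^8+\alpha x^{133}=0$$ has exactly $7$ roots in $\mathbb{R}^2_+$ for every real $\alpha$ with $1936254\leq\alpha\leq 1936838$.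
   Context: $\mathbb{R}^2_+=\{(x,y)\in\mathbb{R}^2 : x>0,\ y>0\}$ is the open positive quadrant. Roots are counted as distinct points, without multiplicity. In general, systems of the form $(\star)$ are allowed to have real exponent vectors; a ''polynomial system'' is one whose exponents are nonnegative integers. The explicit system with parameter $\alpha$ becomes of the form $(\star)$ (a nonzero constant term in each equation, $3$ terms in the first equation and $m=4$ terms in the second) after dividing each equation by one of its monomials, which does not change the roots in $\mathbb{R}^2_+$. *)

(* Defs.v *)
From Stdlib Require Export Reals List.

Set Implicit Arguments.

(* Roots are counted as distinct points, without multiplicity. *)
Definition has_at_least (T : Type) (n : nat) (S : T -> Prop) : Prop :=
  exists l : list T, NoDup l /\ length l = n /\ (forall p, In p l -> S p).

Definition has_exactly (T : Type) (n : nat) (S : T -> Prop) : Prop :=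
  exists l : list T, NoDup l /\ length l = n /\ (forall p, In p l <-> S p).

Open Scope R_scope.

Definition positive_roots (f g : R -> R -> R) (p : R * R) : Prop :=
  let (x, y) := p in 0 < x /\ 0 < y /\ f x y = 0 /\ g x y = 0.

Definition trinomial (alpha1 alpha2 alpha3 : R) (a2 b2 a3 b3 : nat)
    (x y : R) : R :=
  alpha1 + alpha2 * x ^ a2 * y ^ b2 + alpha3 * x ^ a3 * y ^ b3.

(* Only beta 1, ..., beta m and the exponents (c j, d j) for 2 <= j <= m are
   used; sum_f has inclusive bounds and denotes the intended sum for m >= 2. *)
Definition m_nomial (m : nat) (beta : nat -> R) (c d : nat -> nat)
    (x y : R) : R :=
  beta 1%nat + sum_f 2 m (fun j => beta j * x ^ c j * y ^ d j).

(* The exponent vectors of the nonconstant terms of both equations,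
   (a2,b2), (a3,b3), (c 2, d 2), ..., (c m, d m). *)
Definition exponent_vectors (a2 b2 a3 b3 m : nat) (c d : nat -> nat) :
    list (nat * nat) :=
  (a2, b2) :: (a3, b3) :: map (fun j => (c j, d j)) (seq 2 (m - 1)).

(* Main.v *)
(** The first equation of the explicit system is solved by
[x = (y - 44/31 y^3)^(1/6)], and on this branch the second equation becomes
[parameter y = alpha] with a function of one variable.  Seven roots come from
sign changes.  Two applications of Rolle's theorem, separated by a division
that makes one of the three terms constant, reduce the upper bound to counting
the roots of an integer polynomial of degree 23.

For general [m], the case [m = 3] is the system with [alpha = 0], written in
monomial coordinates in which all exponents are nonnegative.  On the branch the
two nonconstant monomials of the first equation are [1 - u] and [31/44 u] for
some [0 < u < 1], so that a product of powers of them is, up to a constant,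
[(u^i (1 - u)^j)^M], a bump that concentrates at [u = i / (i + j)] as [M] grows.
Such a monomial with a suitable coefficient reverses the sign of the second
equation near one point and hardly changes it elsewhere; adding it beyond the
last sign change creates two new roots. *)

From Coquelicot Require Import Coquelicot.
Require Import Defs.
From Stdlib Require Import Reals List Sorted Permutation ZArith Lra Lia.
Open Scope R_scope.

(** * Counting real zeros *)

Definition convex (D : R -> Prop) : Prop :=
  forall x y z, D x -> D z -> x <= y <= z -> D y.

Lemma StronglySorted_Rgt_NoDup (l : list R) : StronglySorted Rgt l -> NoDup l.
Proof.
induction 1 as [|a l Hl IH Ha]; constructor; auto.
intro H; rewrite Forall_forall in Ha; specialize (Ha _ H); lra.
Qed.

Lemma insert_Rgt (l : list R) (x : R) : StronglySorted Rgt l -> ~ In x l ->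
  exists l', StronglySorted Rgt l' /\ Permutation (x :: l) l'.
Proof.
induction 1 as [|a l Hl IH Ha]; intro Hx.
- exists (x :: nil); split; [repeat constructor | reflexivity].
- assert (x <> a) by (intro; subst; apply Hx; left; reflexivity).
  destruct (Rlt_dec a x) as [H1|H1].
  + exists (x :: a :: l); split; [|reflexivity].
    constructor; [constructor; auto|].
    constructor; [exact H1|].
    eapply Forall_impl; [|exact Ha]; intros; simpl in *; lra.
  + destruct IH as [l' [S' P']]; [intro; apply Hx; right; auto|].
    exists (a :: l'); split.
    * constructor; auto.
      apply (Permutation_Forall P'); constructor; [lra|auto].
    * etransitivity; [apply perm_swap|]; constructor; auto.
Qed.

Lemma sort_Rgt (l : list R) : NoDup l ->
  exists l', StronglySorted Rgt l' /\ Permutation l l'.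
Proof.
induction 1 as [|a l Ha Hl [l' [S' P']]].
- exists nil; split; constructor.
- destruct (insert_Rgt _ a S') as [l2 [S2 P2]].
  { intro H; apply Ha; eapply Permutation_in; [symmetry; exact P'|exact H]. }
  exists l2; split; auto; etransitivity; [constructor; exact P'|exact P2].
Qed.

(** Phrased through duplicate-free lists, so that bounding the number of zeros presupposes neither
    finiteness nor decidability of [S]. *)
Definition at_most (n : nat) (S : R -> Prop) : Prop :=
  forall l, NoDup l -> (forall x, In x l -> S x) -> (length l <= n)%nat.

Lemma at_most_sub (n : nat) (S S' : R -> Prop) :
  (forall x, S x -> S' x) -> at_most n S' -> at_most n S.
Proof. intros H A l N I; apply A; auto. Qed.

Lemma at_most_0 (S : R -> Prop) : (forall x, ~ S x) -> at_most 0 S.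
Proof. intros H [|a l] N I; simpl; [lia|destruct (H a); apply I; left; auto]. Qed.

Lemma at_most_split (t : R) (n m : nat) (S : R -> Prop) :
  at_most n (fun x => x < t /\ S x) -> at_most m (fun x => t <= x /\ S x) ->
  at_most (n + m) S.
Proof.
intros A B l N I.
set (p := fun x => if Rlt_dec x t then true else false).
rewrite <- (filter_length p l).
apply Nat.add_le_mono.
- apply A; [apply NoDup_filter; auto|].
  intros x Hx; apply filter_In in Hx as [H1 H2]; unfold p in H2.
  destruct (Rlt_dec x t); [auto|discriminate].
- apply B; [apply NoDup_filter; auto|].
  intros x Hx; apply filter_In in Hx as [H1 H2]; unfold p in H2.
  destruct (Rlt_dec x t); [discriminate|split; [lra|auto]].
Qed.

(** The mean value theorem gives a zero of [f'] between any two neighbours of the decreasing list.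
    Keeping the new zeros below the head [a] is what lets the induction prepend the next one. *)
Lemma rolle_list (D : R -> Prop) (f f' : R -> R) (l : list R) (a : R) :
  convex D -> (forall x, D x -> derivable_pt_lim f x (f' x)) ->
  StronglySorted Rgt (a :: l) ->
  (forall x, In x (a :: l) -> D x /\ f x = 0) ->
  exists l', length l' = length l /\ StronglySorted Rgt l' /\
    Forall (Rgt a) l' /\ (forall x, In x l' -> D x /\ f' x = 0).
Proof.
intros D_convex f_deriv; revert a; induction l as [|b l IH]; intros a Hs H.
- exists nil; repeat split; try constructor; contradiction.
- inversion Hs as [|? ? Hs' Ha]; subst.
  destruct (IH b Hs') as [l' [Hl [S' [F' I']]]].
  { intros; apply H; right; auto. }
  destruct (H a (or_introl eq_refl)) as [Da Za].
  destruct (H b (or_intror (or_introl eq_refl))) as [Db Zb].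
  assert (ba : b < a) by (inversion Ha; auto).
  destruct (MVT_cor2 f f' b a ba) as [c [Hc1 Hc2]].
  { intros; apply f_deriv; eapply D_convex; [exact Db|exact Da|auto]. }
  exists (c :: l'); split; [simpl; lia|split; [|split]].
  + constructor; auto; eapply Forall_impl; [|exact F']; simpl; intros; lra.
  + constructor; [lra|]; eapply Forall_impl; [|exact F']; simpl; intros; lra.
  + intros x [<-|Hx]; [|auto].
    split; [eapply D_convex; [exact Db|exact Da|lra]|].
    assert (f' c * (a - b) = 0) by lra.
    destruct (Rmult_integral _ _ H0); [auto|lra].
Qed.

Lemma rolle_at_most (D : R -> Prop) (f f' : R -> R) (n : nat) :
  convex D -> (forall x, D x -> derivable_pt_lim f x (f' x)) ->
  at_most n (fun x => D x /\ f' x = 0) -> at_most (S n) (fun x => D x /\ f x = 0).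
Proof.
intros D_convex f_deriv A l N I.
destruct (sort_Rgt _ N) as [l1 [S1 P1]].
rewrite (Permutation_length P1).
destruct l1 as [|a l1]; [simpl; lia|].
destruct (rolle_list D f f' l1 a D_convex f_deriv S1) as [l' [Hl [S' [F' I']]]].
{ intros x Hx; apply I; eapply Permutation_in; [symmetry; exact P1|exact Hx]. }
simpl; rewrite <- Hl; apply le_n_S, A; auto.
apply StronglySorted_Rgt_NoDup; auto.
Qed.

(** * Roots forced by sign changes *)

(* The sample points are listed in decreasing order. *)
Fixpoint alternates (f : R -> R) (l : list R) : Prop :=
  match l with
  | a :: ((b :: _) as l') => b < a /\ f a * f b < 0 /\ alternates f l'
  | _ => True
  end.

Lemma sign_change_root (f : R -> R) (a b : R) : a < b ->
  (forall x, a <= x <= b -> continuity_pt f x) -> f b * f a < 0 ->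
  exists z, a < z < b /\ f z = 0.
Proof.
intros ab C H.
assert (K : exists z, a <= z <= b /\ f z = 0).
{ destruct (Rlt_dec (f a) 0) as [na|pa].
  - assert (pb : 0 < f b) by nra.
    destruct (Ranalysis5.IVT_interv f a b C ab na pb) as [z Hz]; eauto.
  - assert (0 < f a) by (destruct (Req_dec (f a) 0) as [E|E]; [rewrite E in H|]; lra).
    destruct (Ranalysis5.IVT_interv (- f)%F a b) as [z [Hz1 Hz2]].
    + intros; apply continuity_pt_opp; auto.
    + auto.
    + unfold opp_fct; nra.
    + unfold opp_fct; nra.
    + exists z; split; auto; unfold opp_fct in Hz2; lra. }
destruct K as [z [Hz Z]]; exists z; split; [|auto].
assert (z <> a) by (intro; subst; rewrite Z in H; lra).
assert (z <> b) by (intro; subst; rewrite Z in H; lra).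
lra.
Qed.

Lemma alternates_roots (D : R -> Prop) (f : R -> R) (l : list R) (a : R) :
  convex D -> (forall x, D x -> continuity_pt f x) ->
  Forall D (a :: l) -> alternates f (a :: l) ->
  exists l', length l' = length l /\ StronglySorted Rgt l' /\
    Forall (Rgt a) l' /\ (forall x, In x l' -> D x /\ f x = 0).
Proof.
intros DC C; revert a; induction l as [|b l IH]; intros a HD HA.
- exists nil; repeat split; try constructor; contradiction.
- inversion HD as [|? ? Da HD']; subst.
  assert (Db : D b) by (inversion HD'; auto).
  destruct HA as [ba [Hs HA']].
  destruct (IH b HD' HA') as [l' [Hl [S' [F' I']]]].
  destruct (sign_change_root f b a ba) as [c [Hc Zc]]; [|exact Hs|].
  { intros; apply C; eapply DC; [exact Db|exact Da|auto]. }
  exists (c :: l'); split; [simpl; lia|split; [|split]].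
  + constructor; auto; eapply Forall_impl; [|exact F']; simpl; intros; lra.
  + constructor; [lra|]; eapply Forall_impl; [|exact F']; simpl; intros; lra.
  + intros x [<-|Hx]; [|auto].
    split; [eapply DC; [exact Db|exact Da|lra]|auto].
Qed.

Lemma alternates_ext_sign (f g : R -> R) (l : list R) :
  (forall x, In x l -> 0 < f x * g x) -> alternates f l -> alternates g l.
Proof.
induction l as [|a [|b l] IH]; intros H HA; auto.
destruct HA as [ba [Hs HA]].
split; [auto|split; [|apply IH; auto; intros; apply H; right; auto]].
pose proof (H a (or_introl eq_refl)) as Ha.
pose proof (H b (or_intror (or_introl eq_refl))) as Hb.
destruct (Rlt_dec (g a * g b) 0) as [|K]; auto.
pose proof (Rmult_lt_0_compat _ _ Ha Hb). 
assert (f a * f b * (g a * g b) <= 0) by nra. nra.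
Qed.

Lemma same_sign_near (a b : R) : Rabs (b - a) < Rabs a -> 0 < a * b.
Proof. unfold Rabs; repeat destruct Rcase_abs; nra. Qed.

Lemma same_sign_trans (a b c : R) : 0 < a * b -> 0 < b * c -> 0 < a * c.
Proof.
intros h1 h2.
assert (0 < b * b) by (assert (b <> 0) by (intro E; rewrite E in h1; lra); nra).
pose proof (Rmult_lt_0_compat _ _ h1 h2); nra.
Qed.

Lemma alternates_head_max (f : R -> R) (l : list R) (a y : R) :
  alternates f (a :: l) -> In y (a :: l) -> y <= a.
Proof.
revert a; induction l as [|b l IH]; intros a HA [<-|hy]; try lra; [contradiction|].
destruct HA as [ba [_ HA]]; pose proof (IH b HA hy); lra.
Qed.

(** The sample values are finitely many and nonzero, so the least of their absolute values serves as
    [d]. A single sample point could carry the value 0, hence the condition on the length. With [g]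
    equal to [f] the lemma also yields that the sample values do not vanish. *)
Lemma alternates_stable (f : R -> R) (l : list R) : alternates f l ->
  (1 < length l)%nat ->
  exists d, 0 < d /\ forall g, (forall x, In x l -> Rabs (g x - f x) < d) ->
    forall x, In x l -> 0 < f x * g x.
Proof.
induction l as [|a [|b l] IH]; intros HA HL; simpl in HL; try lia.
destruct HA as [ba [Hs HA]].
assert (na : f a <> 0) by (intro E; rewrite E in Hs; lra).
assert (nb : f b <> 0) by (intro E; rewrite E in Hs; lra).
pose proof (Rabs_pos_lt _ na); pose proof (Rabs_pos_lt _ nb).
assert (K : exists d, 0 < d /\ forall g, (forall x, In x (b :: l) -> Rabs (g x - f x) < d) ->
    forall x, In x (b :: l) -> 0 < f x * g x).
{ destruct l as [|c l].
  - exists (Rabs (f b)); split; auto; intros g Hg x [<-|[]].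
    apply same_sign_near; apply Hg; left; auto.
  - apply IH; auto; simpl; lia. }
destruct K as [d [d0 K]].
exists (Rmin d (Rabs (f a))); split; [apply Rmin_glb_lt; auto|].
intros g Hg x [<-|Hx].
- apply same_sign_near; eapply Rlt_le_trans; [apply Hg; left; auto|apply Rmin_r].
- apply K; auto; intros y Hy; eapply Rlt_le_trans; [apply Hg; right; auto|apply Rmin_l].
Qed.

(** * Certified root bounds for integer polynomials *)

Fixpoint peval (p : list Z) (x : R) : R :=
  match p with nil => 0 | c :: q => IZR c + x * peval q x end.

Fixpoint padd (p q : list Z) : list Z :=
  match p, q with
  | nil, _ => q
  | _, nil => p
  | a :: p', b :: q' => (a + b)%Z :: padd p' q'
  end.

Definition pscale (a : Z) (p : list Z) : list Z := map (Z.mul a) p.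

Fixpoint pmul (p q : list Z) : list Z :=
  match p with nil => nil | a :: p' => padd (pscale a q) (0%Z :: pmul p' q) end.

Fixpoint ppow (p : list Z) (n : nat) : list Z :=
  match n with O => 1%Z :: nil | S n' => pmul p (ppow p n') end.

Fixpoint pderiv (p : list Z) : list Z :=
  match p with nil => nil | _ :: q => padd q (0%Z :: pderiv q) end.

Lemma peval_padd (p q : list Z) (x : R) :
  peval (padd p q) x = peval p x + peval q x.
Proof.
revert q; induction p as [|a p IH]; intros [|b q]; simpl; try ring.
rewrite IH, plus_IZR; ring.
Qed.

Lemma peval_pscale (a : Z) (p : list Z) (x : R) :
  peval (pscale a p) x = IZR a * peval p x.
Proof.
unfold pscale; induction p as [|b p IH]; simpl; [ring|].
rewrite IH, mult_IZR; ring.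
Qed.

Lemma peval_pmul (p q : list Z) (x : R) :
  peval (pmul p q) x = peval p x * peval q x.
Proof.
induction p as [|a p IH]; simpl; [ring|].
rewrite peval_padd, peval_pscale; simpl; rewrite IH; ring.
Qed.

Lemma peval_ppow (p : list Z) (n : nat) (x : R) :
  peval (ppow p n) x = peval p x ^ n.
Proof.
induction n as [|n IH]; simpl; [ring|].
rewrite peval_pmul, IH; ring.
Qed.

Lemma peval_deriv (p : list Z) (x : R) :
  derivable_pt_lim (peval p) x (peval (pderiv p) x).
Proof.
induction p as [|a p IH].
- exact (derivable_pt_lim_const 0 x).
- change (pderiv (a :: p)) with (padd p (0%Z :: pderiv p)).
  rewrite peval_padd; simpl.
  replace (peval p x + (0 + x * peval (pderiv p) x))
    with (0 + (1 * peval p x + id x * peval (pderiv p) x)) by (unfold id; ring).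
  apply (derivable_pt_lim_plus (fun _ => IZR a) (id * peval p)%F).
  + apply derivable_pt_lim_const.
  + apply derivable_pt_lim_mult; [apply derivable_pt_lim_id|exact IH].
Qed.

(* For [(q, e) = psubst p a w d], [q(t) = e * p((a + w t) / d)] and [e > 0]. *)
Fixpoint psubst (p : list Z) (a w d : Z) : list Z * Z :=
  match p with
  | nil => (nil, 1%Z)
  | c :: p' =>
      let (q, e) := psubst p' a w d in
      (padd ((c * e * d)%Z :: nil) (pmul (a :: w :: nil) q), (e * d)%Z)
  end.

Lemma psubst_spec (p : list Z) (a w d : Z) (t : R) : (0 < d)%Z ->
  (0 < snd (psubst p a w d))%Z /\
  peval (fst (psubst p a w d)) t =
    IZR (snd (psubst p a w d)) * peval p ((IZR a + IZR w * t) / IZR d).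
Proof.
intro hd; induction p as [|c p IH]; [simpl; split; [lia|ring]|].
cbn [psubst]; destruct (psubst p a w d) as [q e]; cbn [fst snd] in *.
destruct IH as [he IH]; split; [lia|].
rewrite peval_padd, peval_pmul; simpl; rewrite IH, !mult_IZR.
field; apply not_0_IZR; lia.
Qed.

(** Horner's rule for a lower bound on [[0, 1]]: if [q(t) >= m], then [t q(t) >= min(0, m)]. *)
Fixpoint plower (p : list Z) : Z :=
  match p with nil => 0%Z | c :: q => (c + Z.min 0 (plower q))%Z end.

Lemma plower_spec (p : list Z) (t : R) : 0 <= t <= 1 ->
  IZR (plower p) <= peval p t.
Proof.
intro ht; induction p as [|c p IH]; simpl; [lra|].
rewrite plus_IZR; apply Rplus_le_compat_l.
destruct (Z.min_spec 0 (plower p)) as [[H ->]|[H ->]].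
- apply IZR_lt in H; nra.
- apply IZR_le in H; nra.
Qed.

(** The interval [[a/d, b/d]] is carried to [[0, 1]], where [p] or [-p] should have a positive lower
    bound; [false] is inconclusive. *)
Definition nonzero_on (p : list Z) (a b d : Z) : bool :=
  let q := fst (psubst p a (b - a) d) in
  Z.ltb 0 (plower q) || Z.ltb 0 (plower (pscale (-1) q)).

Lemma nonzero_on_spec (p : list Z) (a b d : Z) (x : R) :
  nonzero_on p a b d = true -> (a < b)%Z -> (0 < d)%Z ->
  IZR a <= x * IZR d <= IZR b -> peval p x <> 0.
Proof.
unfold nonzero_on; intros H hab hd hx Z.
pose proof (IZR_lt _ _ hab) as hab'; pose proof (IZR_lt _ _ hd) as hd'.
set (t := (x * IZR d - IZR a) / (IZR b - IZR a)).
assert (ht : 0 <= t <= 1).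
{ split; unfold t.
  - apply Rmult_le_pos; [lra|left; apply Rinv_0_lt_compat; lra].
  - apply (Rmult_le_reg_r (IZR b - IZR a)); [lra|]; field_simplify; lra. }
destruct (psubst_spec p a (b - a) d t hd) as [_ E].
replace ((IZR a + IZR (b - a) * t) / IZR d) with x in E
  by (rewrite minus_IZR; unfold t; field; lra).
rewrite Z, Rmult_0_r in E.
apply Bool.orb_prop in H as [H|H]; apply Z.ltb_lt, IZR_lt in H;
  pose proof (Rlt_le_trans _ _ _ H (plower_spec _ t ht)) as L.
- lra.
- rewrite peval_pscale in L; lra.
Qed.

(** Bisection of [[a/d, b/d]], with integer endpoints kept by doubling the denominator. A piece is
    discarded when [p] has no zero there; at full depth a piece on which the derivative [p'] has no
    zero counts for one root, by Rolle. *)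
Fixpoint root_bound (fuel : nat) (p p' : list Z) (a b d : Z) : option nat :=
  if nonzero_on p a b d then Some 0%nat else
  match fuel with
  | O => if nonzero_on p' a b d then Some 1%nat else None
  | S k =>
      match root_bound k p p' (2 * a) (a + b) (2 * d),
            root_bound k p p' (a + b) (2 * b) (2 * d) with
      | Some m, Some n => Some (m + n)%nat
      | _, _ => None
      end
  end.

Lemma root_bound_spec (fuel : nat) (p : list Z) (a b d : Z) (n : nat) :
  root_bound fuel p (pderiv p) a b d = Some n -> (a < b)%Z -> (0 < d)%Z ->
  at_most n (fun x => IZR a <= x * IZR d <= IZR b /\ peval p x = 0).
Proof.
revert a b d n; induction fuel as [|k IH]; intros a b d n; cbn [root_bound];
  destruct (nonzero_on p a b d) eqn:E; intros H hab hd.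
- injection H as <-; apply at_most_0; intros x [h1 h2].
  exact (nonzero_on_spec _ _ _ _ _ E hab hd h1 h2).
- destruct (nonzero_on (pderiv p) a b d) eqn:E'; [|discriminate].
  injection H as <-.
  apply (rolle_at_most (fun x => IZR a <= x * IZR d <= IZR b) (peval p) (peval (pderiv p))).
  + intros x y z hx hz hxz; apply IZR_lt in hd; nra.
  + intros; apply peval_deriv.
  + apply at_most_0; intros x [h1 h2].
    exact (nonzero_on_spec _ _ _ _ _ E' hab hd h1 h2).
- injection H as <-; apply at_most_0; intros x [h1 h2].
  exact (nonzero_on_spec _ _ _ _ _ E hab hd h1 h2).
- destruct (root_bound k p (pderiv p) (2 * a) (a + b) (2 * d)) as [n1|] eqn:E1; [|discriminate].
  destruct (root_bound k p (pderiv p) (a + b) (2 * b) (2 * d)) as [n2|] eqn:E2; [|discriminate].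
  injection H as <-.
  assert (hd' : 0 < IZR d) by (apply IZR_lt; auto).
  apply (at_most_split (IZR (a + b) / IZR (2 * d))).
  + eapply at_most_sub; [|apply (IH _ _ _ _ E1); lia].
    intros x [h1 [h2 h3]]; split; [|auto].
    apply Rmult_lt_compat_r with (r := IZR (2 * d)) in h1; [|apply IZR_lt; lia].
    unfold Rdiv in h1; rewrite Rmult_assoc, Rinv_l, Rmult_1_r in h1;
      [|apply not_0_IZR; lia].
    rewrite !mult_IZR in *; lra.
  + eapply at_most_sub; [|apply (IH _ _ _ _ E2); lia].
    intros x [h1 [h2 h3]]; split; [|auto].
    apply Rmult_le_compat_r with (r := IZR (2 * d)) in h1; [|apply IZR_le; lia].
    unfold Rdiv in h1; rewrite Rmult_assoc, Rinv_l, Rmult_1_r in h1;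
      [|apply not_0_IZR; lia].
    rewrite !mult_IZR in *; lra.
Qed.

(** * The explicit system: at most seven roots *)

Definition cubic (y : R) : R := y - 44 / 31 * y ^ 3.
Definition on_branch (y : R) : Prop := 0 < y /\ 44 * y ^ 2 < 31.
Definition branch (y : R) : R := Rpower (cubic y) (/ 6).

Lemma on_branch_convex : convex on_branch.
Proof. intros x y z [hx hx'] [hz hz'] hy; split; nra. Qed.

Lemma cubic_pos (y : R) : on_branch y -> 0 < cubic y.
Proof.
intros [h h']; unfold cubic.
replace (y - 44 / 31 * y ^ 3) with (y * (31 - 44 * y ^ 2) / 31) by field.
apply Rmult_lt_0_compat; [apply Rmult_lt_0_compat|]; lra.
Qed.

Lemma on_branch_cubic (y : R) : 0 < y -> 0 < cubic y -> on_branch y.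
Proof.
unfold cubic; intros h H; split; [auto|].
replace (y - 44 / 31 * y ^ 3) with (y * (31 - 44 * y ^ 2) / 31) in H by field.
nra.
Qed.

Lemma branch_pos (y : R) : 0 < branch y.
Proof. apply exp_pos. Qed.

Lemma branch_pow6 (y : R) : on_branch y -> branch y ^ 6 = cubic y.
Proof.
intro h; pose proof (cubic_pos _ h) as hc.
rewrite <- Rpower_pow by apply branch_pos; unfold branch.
rewrite Rpower_mult; replace (/ 6 * INR 6) with 1 by (simpl; field).
apply Rpower_1; auto.
Qed.

Lemma branch_unique (x y : R) : 0 < x -> x ^ 6 = cubic y -> x = branch y.
Proof.
intros hx h; unfold branch; rewrite <- h, <- Rpower_pow by auto.
rewrite Rpower_mult; replace (INR 6 * / 6) with 1 by (simpl; field).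
symmetry; apply Rpower_1; auto.
Qed.

Lemma branch_derive (y : R) : on_branch y ->
  is_derive branch y (branch y * ((1 - 132 / 31 * y ^ 2) / (6 * cubic y))).
Proof.
intro h; pose proof (cubic_pos _ h) as hc; unfold branch, Rpower.
unfold cubic in *; auto_derive; [exact hc|].
change (y * (y * (y * 1))) with (y ^ 3).
change (y + - (44 / 31 * y ^ 3)) with (y - 44 / 31 * y ^ 3).
field; lra.
Qed.

Lemma branch_pow_derive (n : nat) (y : R) : on_branch y ->
  is_derive (fun z => branch z ^ n) y
    (INR n * branch y ^ n * ((1 - 132 / 31 * y ^ 2) / (6 * cubic y))).
Proof.
intro h; pose proof (is_derive_pow _ n _ _ (branch_derive y h)) as H.
set (k := (1 - 132 / 31 * y ^ 2) / (6 * cubic y)) in *.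
replace (INR n * branch y ^ n * k)
  with (INR n * (branch y * k) * branch y ^ Init.Nat.pred n); [exact H|].
destruct n as [|n]; [simpl; ring|].
cbn [Init.Nat.pred]; rewrite <- (tech_pow_Rmult (branch y) n); ring.
Qed.

(* On the branch the second equation says [parameter y = alpha]. *)
Definition parameter (y : R) : R :=
  (branch y - 44 / 31 * branch y ^ 3 - y ^ 6) * y ^ 8 / branch y ^ 133.

(* With [u = 44/31 y^2] (so [0 < u < 1] on the branch), [pv], [m1], [m2], [m3]
   are [31 (1 - u)], [31 (29 u - 7)], [31 (171 u - 41)], [31 (45 u - 7)]; the
   last three come from the logarithmic derivatives of the three terms of
   [parameter]. *)
Definition pv : list Z := (31 :: 0 :: -44 :: nil)%Z.
Definition m1 : list Z := (-217 :: 0 :: 1276 :: nil)%Z.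
Definition m2 : list Z := (-1271 :: 0 :: 7524 :: nil)%Z.
Definition m3 : list Z := (-217 :: 0 :: 1980 :: nil)%Z.

(** Numerator of the derivative of [parameter], up to a positive factor. *)
Definition critical (y : R) : R :=
  372 * branch y * peval m1 y - 88 * branch y ^ 3 * peval m2 y
  - 217 * y ^ 6 * peval m3 y.

Lemma parameter_derive (y : R) : on_branch y ->
  is_derive parameter y
    (critical y * (y ^ 8 / (961 * (6 * cubic y) * branch y ^ 133))).
Proof.
intro h; pose proof (cubic_pos _ h) as hc; pose proof (branch_pos y) as hb.
unfold parameter.
(* Naming the powers keeps [auto_derive] and [field] from expanding the exponent 133. *)
set (W := fun z => branch z ^ 133); set (V := fun z => branch z ^ 3).
change (is_derive (fun z => (branch z - 44 / 31 * V z - z ^ 6) * z ^ 8 / W z) y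
  (critical y * (y ^ 8 / (961 * (6 * cubic y) * W y)))).
set (k := (1 - 132 / 31 * y ^ 2) / (6 * cubic y)).
assert (H1 : is_derive branch y (branch y * k)) by (apply branch_derive; auto).
assert (H3 : is_derive V y (INR 3 * V y * k)) by (apply branch_pow_derive; auto).
assert (H133 : is_derive W y (INR 133 * W y * k)) by (apply branch_pow_derive; auto).
assert (hW : 0 < W y) by (apply pow_lt; auto).
auto_derive.
- repeat split; try (eexists; eassumption); lra.
- change (fun x => branch x) with branch; change (fun x => V x) with V; change (fun x => W x) with W.
  rewrite (is_derive_unique _ _ _ H1), (is_derive_unique _ _ _ H3), (is_derive_unique _ _ _ H133).
  unfold critical; change (branch y ^ 3) with (V y); clearbody V W.
  replace (INR 133) with 133 by (rewrite INR_IZR_INZ; reflexivity).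
  replace (INR 3) with 3 by (rewrite INR_IZR_INZ; reflexivity).
  unfold k, cubic in *; simpl peval.
  field; split; lra.
Qed.

(** Confines the zeros of [critical] to the interval where [m1] is positive, so that [ratio] may
    divide by it. *)
Lemma critical_neg (y : R) : on_branch y -> peval m1 y <= 0 -> critical y < 0.
Proof.
intros h H; pose proof (branch_pow6 y h) as h6; pose proof (branch_pos y) as hb.
pose proof (proj1 h) as hy; unfold cubic in h6; unfold critical.
replace (peval m1 y) with (1276 * y ^ 2 - 217) in * by (simpl; ring).
replace (peval m2 y) with (7524 * y ^ 2 - 1271) by (simpl; ring).
replace (peval m3 y) with (1980 * y ^ 2 - 217) by (simpl; ring).
set (x := branch y) in *.
assert (y1 : y < 33 / 80) by nra.
assert (y4 : y ^ 4 <= 3 / 100) by nra.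
assert (y5 : 0 < y ^ 5 <= 3 / 100 * y) by (split; [apply pow_lt; lra|nra]).
assert (hx : y < x).
{ apply Rnot_le_lt; intro L.
  pose proof (pow_incr x y 6 ltac:(lra)) as L6.
  rewrite h6 in L6.
  assert (0 < y * (1 - 44 / 31 * y ^ 2 - y ^ 5)) by (apply Rmult_lt_0_compat; lra).
  lra. }
assert (hz : 44 / 31 * x ^ 2 < 1).
{ apply Rnot_le_lt; intro L.
  pose proof (pow_incr 1 (44 / 31 * x ^ 2) 3 ltac:(lra)) as L3.
  rewrite pow1, Rpow_mult_distr, <- pow_mult in L3; simpl Nat.mul in L3.
  rewrite h6 in L3.
  assert (y - 44 / 31 * y ^ 3 <= 8 / 25) by nra.
  lra. }
assert (y6 : 0 < y ^ 6) by (apply pow_lt; lra).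
destruct (Rle_dec 0 (7524 * y ^ 2 - 1271)) as [M2|M2].
- assert (0 < y ^ 6 * (1980 * y ^ 2 - 217)) by (apply Rmult_lt_0_compat; lra).
  assert (0 <= x ^ 3 * (7524 * y ^ 2 - 1271)) by (apply Rmult_le_pos; [apply pow_le; lra|lra]).
  nra.
(* Replacing [88 x^3] by [62 x] bounds the sum of the first two terms by [-62 x (31 - 132 y^2)],
   which [B] shows to outweigh the third. *)
- assert (A : 88 * x ^ 3 * (1271 - 7524 * y ^ 2) <= 62 * x * (1271 - 7524 * y ^ 2)).
  { apply Rmult_le_compat_r; [lra|].
    replace (88 * x ^ 3) with (62 * x * (44 / 31 * x ^ 2)) by field.
    nra. }
  assert (B : 217 * y ^ 6 * (217 - 1980 * y ^ 2) < 62 * x * (31 - 132 * y ^ 2)).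
  { destruct (Rle_dec 0 (1980 * y ^ 2 - 217)) as [M3|M3].
    - assert (0 <= y ^ 6 * (1980 * y ^ 2 - 217)) by (apply Rmult_le_pos; lra).
      assert (0 < x * (31 - 132 * y ^ 2)) by (apply Rmult_lt_0_compat; lra).
      nra.
    - assert (y < 1 / 3) by nra.
      assert (y ^ 4 <= 1 / 80) by nra.
      assert (y ^ 6 <= 1 / 240 * y) by nra.
      assert (217 * y ^ 6 * (217 - 1980 * y ^ 2) <= 217 * y ^ 6 * 217)
        by (apply Rmult_le_compat_l; nra).
      assert (62 * x * 16 <= 62 * x * (31 - 132 * y ^ 2)) by (apply Rmult_le_compat_l; nra).
      lra. }
  nra.
Qed.

(* Dividing by the first term before differentiating again lowers the degree of
   the eliminant [pK] below to 23. *)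
Definition ratio (y : R) : R :=
  1 - 22 / 93 * branch y ^ 2 * (peval m2 y / peval m1 y)
  - 7 / 12 * (y ^ 6 / branch y) * (peval m3 y / peval m1 y).

Lemma critical_ratio (y : R) : peval m1 y <> 0 ->
  critical y = 372 * branch y * peval m1 y * ratio y.
Proof.
intro h; pose proof (branch_pos y); unfold critical, ratio; field; lra.
Qed.

(** [pP] and [pQ] are the numerators of the derivatives of the two nonconstant terms of [ratio]. The
    first summand comes from the powers of [branch y] and [y], the second from the quotients
    [m2 / m1] and [m3 / m1]. *)
Definition pP : list Z :=
  padd (pmul (31 :: 0 :: -132 :: nil)%Z (pmul m1 m2))
       (pmul (0 :: 0 :: -65472 :: nil)%Z pv).
Definition pQ : list Z :=
  padd (pmul (1085 :: 0 :: -1452 :: nil)%Z (pmul m1 m3))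
       (pmul (0 :: 0 :: -1833216 :: nil)%Z pv).

(** Numerator of the derivative of [ratio], up to a nonvanishing factor. The branch enters only
    through its cube, so one squaring reaches the sixth power, which is a polynomial in [y]. *)
Definition critical2 (y : R) : R :=
  176 * branch y ^ 3 * peval pP y + 217 * y ^ 6 * peval pQ y.

Lemma ratio_derive (y : R) : on_branch y -> peval m1 y <> 0 ->
  is_derive ratio y
    (critical2 y *
     (- / (69192 * branch y * peval m1 y ^ 2 * cubic y))).
Proof.
intros h hm; pose proof (cubic_pos _ h) as hc; pose proof (branch_pos y) as hb.
set (k := (1 - 132 / 31 * y ^ 2) / (6 * cubic y)).
assert (H1 : is_derive branch y (branch y * k)) by (apply branch_derive; auto).
unfold ratio, critical2, pP, pQ.
rewrite !peval_padd, !peval_pmul.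
simpl peval in *.
auto_derive.
- repeat split; try (eexists; eassumption); try lra; intro K; apply hm; rewrite <- K; ring.
- change (fun x => branch x) with branch.
  rewrite (is_derive_unique _ _ _ H1).
  unfold k, cubic in *; field; repeat split; try lra; intro K; apply hm; rewrite <- K; ring.
Qed.

Definition monomial (n : nat) : list Z := ppow (0 :: 1 :: nil)%Z n.

(* Squaring [critical2 y = 0] and substituting [x^6 = y - 44/31 y^3]
   eliminates [x]. *)
Definition pK : list Z :=
  padd (pscale (31 * 217 ^ 2) (pmul (monomial 11) (ppow pQ 2)))
       (pscale (- 176 ^ 2) (pmul pv (ppow pP 2))).

Lemma peval_monomial (n : nat) (x : R) : peval (monomial n) x = x ^ n.
Proof. unfold monomial; rewrite peval_ppow; f_equal; simpl; ring. Qed.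

Lemma critical2_eliminant (y : R) : on_branch y -> critical2 y = 0 ->
  peval pK y = 0.
Proof.
intros h H; pose proof (branch_pow6 y h) as h6; unfold cubic in h6.
unfold critical2 in H; unfold pK.
rewrite !peval_padd, !peval_pscale, !peval_pmul, !peval_monomial, !peval_ppow.
revert H; generalize (peval pP y) (peval pQ y); intros P Q H.
replace (peval pv y) with (31 - 44 * y ^ 2) by (simpl; ring).
change (31 * 217 ^ 2)%Z with 1459759%Z; change (- 176 ^ 2)%Z with (-30976)%Z.
destruct h as [h _].
apply (Rmult_eq_reg_l y); [|lra]; rewrite Rmult_0_r.
transitivity (31 * ((217 * y ^ 6 * Q) ^ 2 - 176 ^ 2 * branch y ^ 6 * P ^ 2)).
- rewrite h6; field.
- replace (217 * y ^ 6 * Q) with (- (176 * branch y ^ 3 * P)) by lra; ring.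
Qed.

(** The interval [[12/32, 27/32]] contains [ratio_domain], which is roughly [(0.412, 0.839)]. *)
Lemma eliminant_root_bound : root_bound 5 pK (pderiv pK) 12 27 32 = Some 5%nat.
Proof. vm_cast_no_check (eq_refl (Some 5%nat)). Qed.

Definition ratio_domain (y : R) : Prop := on_branch y /\ 0 < peval m1 y.

Lemma ratio_domain_convex : convex ratio_domain.
Proof.
intros x y z [hx hx'] [hz hz'] hy.
split; [exact (on_branch_convex x y z hx hz hy)|].
destruct hx as [hx _]; simpl in *; nra.
Qed.

Lemma ratio_at_most_6 : at_most 6 (fun y => ratio_domain y /\ ratio y = 0).
Proof.
apply (rolle_at_most ratio_domain ratio (fun y => critical2 y *
     (- / (69192 * branch y * peval m1 y ^ 2 * cubic y)))).
- exact ratio_domain_convex.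
- intros y [h hm]; apply is_derive_Reals, ratio_derive; [auto|lra].
- eapply at_most_sub;
    [|apply (root_bound_spec _ _ _ _ _ _ eliminant_root_bound); lia].
  intros y [[h hm] H]; split; [destruct h; simpl in hm; split; nra|].
  apply critical2_eliminant; auto.
  destruct (Rmult_integral _ _ H) as [K|K]; [auto|exfalso].
  revert K; apply Ropp_neq_0_compat, Rinv_neq_0_compat, Rgt_not_eq.
  pose proof (cubic_pos y h); pose proof (branch_pos y).
  pose proof (pow_lt _ 2 hm).
  repeat apply Rmult_lt_0_compat; lra.
Qed.

Lemma critical_at_most_6 : at_most 6 (fun y => on_branch y /\ critical y = 0).
Proof.
eapply at_most_sub; [|exact ratio_at_most_6].
intros y [h H].
assert (hm : 0 < peval m1 y).
{ apply Rnot_le_lt; intro L; pose proof (critical_neg y h L); lra. }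
split; [split; auto|].
rewrite critical_ratio in H by lra; pose proof (branch_pos y).
destruct (Rmult_integral _ _ H) as [K|K]; [exfalso|exact K].
revert K; apply Rgt_not_eq; repeat apply Rmult_lt_0_compat; lra.
Qed.

Lemma parameter_at_most_7 (alpha : R) :
  at_most 7 (fun y => on_branch y /\ parameter y = alpha).
Proof.
apply (at_most_sub _ _ (fun y => on_branch y /\ parameter y - alpha = 0)).
{ intros y [h H]; split; [auto|lra]. }
apply (rolle_at_most on_branch (fun y => parameter y - alpha)
  (fun y => critical y * (y ^ 8 / (961 * (6 * cubic y) * branch y ^ 133)))).
- exact on_branch_convex.
- intros y h.
  rewrite <- (Rminus_0_r (critical y * _)).
  apply (derivable_pt_lim_minus parameter (fun _ => alpha));
    [apply is_derive_Reals, parameter_derive; auto|apply derivable_pt_lim_const].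
- eapply at_most_sub; [|exact critical_at_most_6].
  intros y [h H]; split; [auto|].
  destruct (Rmult_integral _ _ H) as [K|K]; [auto|exfalso].
  revert K; apply Rgt_not_eq, Rdiv_lt_0_compat; [apply pow_lt, h|].
  pose proof (cubic_pos y h); pose proof (pow_lt _ 133 (branch_pos y)).
  apply Rmult_lt_0_compat; lra.
Qed.

(** * The explicit system: at least seven roots *)

(** Equal to [branch y ^ 133 * (alpha - parameter y)], but free of division. *)
Definition second (alpha y : R) : R :=
  y ^ 14 + 44 / 31 * branch y ^ 3 * y ^ 8 - branch y * y ^ 8
  + alpha * branch y ^ 133.

(* [31 d^133] times the second polynomial at [y = a / d], with [x = b / d] in
   the third term and [x = c / d] in the others. *)
Definition second_bound (a b c d alpha : Z) : Z :=
  (31 * a ^ Z.of_nat 14 * d ^ Z.of_nat 119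
   + 44 * c ^ Z.of_nat 3 * a ^ Z.of_nat 8 * d ^ Z.of_nat 122
   - 31 * b * a ^ Z.of_nat 8 * d ^ Z.of_nat 124
   + 31 * alpha * c ^ Z.of_nat 133)%Z.

(** Comparing sixth powers, cleared of denominators, decides [b/d < branch (a/d) < (b+1)/d] in
    integer arithmetic. *)
Definition branch_check (a b d : Z) : bool :=
  (Z.ltb 0 a && Z.ltb 0 b && Z.ltb 0 d && Z.ltb (44 * a ^ 2) (31 * d ^ 2) &&
   Z.ltb (31 * b ^ 6) ((31 * a * d ^ 2 - 44 * a ^ 3) * d ^ 3) &&
   Z.ltb ((31 * a * d ^ 2 - 44 * a ^ 3) * d ^ 3) (31 * (b + 1) ^ 6)).

Lemma Rpow_lt_inv (x y : R) (n : nat) : 0 <= y -> x ^ n < y ^ n -> x < y.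
Proof.
intros hy h; apply Rnot_le_lt; intro L.
pose proof (pow_incr y x n (conj hy L)); lra.
Qed.

Lemma branch_check_spec (a b d : Z) : branch_check a b d = true ->
  (0 < a)%Z /\ (0 < b)%Z /\ (0 < d)%Z /\ on_branch (IZR a / IZR d) /\
  IZR b / IZR d < branch (IZR a / IZR d) < IZR (b + 1) / IZR d.
Proof.
unfold branch_check; intro H.
repeat match goal with H : andb _ _ = true |- _ => apply andb_prop in H; destruct H end.
repeat match goal with H : Z.ltb _ _ = true |- _ => apply Z.ltb_lt in H end.
repeat (split; [assumption|]).
assert (hd : 0 < IZR d) by (apply IZR_lt; auto).
assert (ha : 0 < IZR a) by (apply IZR_lt; auto).
assert (hb : 0 < IZR b) by (apply IZR_lt; auto).
assert (hy : on_branch (IZR a / IZR d)).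
{ split; [apply Rdiv_lt_0_compat; auto|].
  apply (Rmult_lt_reg_r (IZR d ^ 2)); [apply pow_lt; auto|].
  replace (44 * (IZR a / IZR d) ^ 2 * IZR d ^ 2) with (44 * IZR a ^ 2) by (field; lra).
  rewrite !pow_IZR, <- !mult_IZR; apply IZR_lt; assumption. }
split; [assumption|].
pose proof (branch_pow6 _ hy) as h6.
assert (hc : 31 * IZR d ^ 6 * cubic (IZR a / IZR d) =
  IZR ((31 * a * d ^ 2 - 44 * a ^ 3) * d ^ 3)).
(* The rewriting with [pow_IZR] needs exponents of the form [Z.of_nat n]. *)
{ change ((31 * a * d ^ 2 - 44 * a ^ 3) * d ^ 3)%Z with
    ((31 * a * d ^ Z.of_nat 2 - 44 * a ^ Z.of_nat 3) * d ^ Z.of_nat 3)%Z.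
  rewrite mult_IZR, minus_IZR, !mult_IZR, <- !pow_IZR.
  unfold cubic; field; lra. }
assert (hd6 : 0 < 31 * IZR d ^ 6) by (pose proof (pow_lt _ 6 hd); lra).
split.
- apply (Rpow_lt_inv _ _ 6); [left; apply branch_pos|rewrite h6].
  apply (Rmult_lt_reg_l (31 * IZR d ^ 6)); [auto|rewrite hc].
  replace (31 * IZR d ^ 6 * (IZR b / IZR d) ^ 6) with (31 * IZR b ^ 6) by (field; lra).
  rewrite pow_IZR, <- mult_IZR; apply IZR_lt; assumption.
- assert (hb1 : 0 < IZR (b + 1)) by (apply IZR_lt; lia).
  apply (Rpow_lt_inv _ _ 6); [left; apply Rdiv_lt_0_compat; auto|rewrite h6].
  apply (Rmult_lt_reg_l (31 * IZR d ^ 6)); [auto|rewrite hc].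
  replace (31 * IZR d ^ 6 * (IZR (b + 1) / IZR d) ^ 6) with (31 * IZR (b + 1) ^ 6) by (field; lra).
  rewrite pow_IZR, <- mult_IZR; apply IZR_lt; assumption.
Qed.

Lemma pow_div_mult (x d : R) (n m : nat) : d <> 0 ->
  (x / d) ^ n * d ^ (n + m) = x ^ n * d ^ m.
Proof.
intro hd; rewrite pow_add, <- Rmult_assoc, <- Rpow_mult_distr.
replace (x / d * d) with x by (field; auto); reflexivity.
Qed.

Lemma second_bound_spec (a b c d alpha : Z) : (0 < d)%Z ->
  let y := IZR a / IZR d in
  IZR (second_bound a b c d alpha) =
  31 * IZR d ^ 133 *
    (y ^ 14 + 44 / 31 * (IZR c / IZR d) ^ 3 * y ^ 8 - IZR b / IZR d * y ^ 8
     + IZR alpha * (IZR c / IZR d) ^ 133).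
Proof.
intros hd y; assert (hd' : IZR d <> 0) by (apply not_0_IZR; lia).
unfold second_bound; rewrite plus_IZR, minus_IZR, plus_IZR, !mult_IZR, <- !pow_IZR.
pose proof (pow_div_mult (IZR a) (IZR d) 14 119 hd') as E1.
pose proof (pow_div_mult (IZR a) (IZR d) 8 125 hd') as E2.
pose proof (pow_div_mult (IZR c) (IZR d) 133 0 hd') as E3.
change (14 + 119)%nat with 133%nat in E1.
change (8 + 125)%nat with 133%nat in E2.
change (133 + 0)%nat with 133%nat in E3.
fold y in E1, E2.
transitivity (31 * (y ^ 14 * IZR d ^ 133)
  + 44 * (IZR c / IZR d) ^ 3 * (y ^ 8 * IZR d ^ 133)
  - 31 * (IZR b / IZR d) * (y ^ 8 * IZR d ^ 133)
  + 31 * IZR alpha * ((IZR c / IZR d) ^ 133 * IZR d ^ 133)).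
- rewrite E1, E2, E3.
  change 125%nat with (122 + 3)%nat; change 124%nat with (122 + 2)%nat.
  rewrite !pow_add; set (D := IZR d ^ 122); set (C := IZR c ^ 133).
  set (D' := IZR d ^ 119); rewrite pow_O; field; auto.
- set (D := IZR d ^ 133); set (C := (IZR c / IZR d) ^ 133); field; auto.
Qed.

(** Interval evaluation term by term: only the linear term decreases in [x], so it takes the
    opposite end of the enclosure. *)
Lemma second_mono (alpha beta xl x xu y : R) : 0 < y -> 0 < xl -> 0 <= alpha -> alpha <= beta ->
  xl <= x <= xu ->
  y ^ 14 + 44 / 31 * xl ^ 3 * y ^ 8 - xu * y ^ 8 + alpha * xl ^ 133 <=
  y ^ 14 + 44 / 31 * x ^ 3 * y ^ 8 - x * y ^ 8 + beta * x ^ 133 /\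
  y ^ 14 + 44 / 31 * x ^ 3 * y ^ 8 - x * y ^ 8 + alpha * x ^ 133 <=
  y ^ 14 + 44 / 31 * xu ^ 3 * y ^ 8 - xl * y ^ 8 + beta * xu ^ 133.
Proof.
intros hy hl ha hab hx.
pose proof (pow_lt y 8 hy) as h8.
assert (A : forall n, xl ^ n <= x ^ n <= xu ^ n) by (intro n; split; apply pow_incr; lra).
pose proof (A 3%nat) as A3; pose proof (A 133%nat) as A133.
pose proof (pow_lt xl 133 hl) as B.
revert A3 A133 B h8.
generalize (y ^ 8) (xl ^ 133) (x ^ 133) (xu ^ 133) (xl ^ 3) (x ^ 3) (xu ^ 3).
intros Y l133 x133 u133 l3 x3 u3 A3 A133 B h8.
assert (alpha * l133 <= beta * x133) by (apply Rmult_le_compat; lra).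
assert (alpha * x133 <= beta * u133) by (apply Rmult_le_compat; lra).
split; nra.
Qed.

(** Since [second] increases with the parameter, a negative sign needs checking only at the upper
    end of a parameter range, and a positive one, in [second_pos], only at the lower end. *)
Lemma second_neg (a b d alpha : Z) (beta : R) :
  branch_check a b d = true ->
  Z.ltb (second_bound a b (b + 1) d alpha) 0 = true ->
  0 <= beta <= IZR alpha ->
  on_branch (IZR a / IZR d) /\ second beta (IZR a / IZR d) < 0.
Proof.
intros H K hb; destruct (branch_check_spec _ _ _ H) as [ha [hb' [hd [hy [hl hu]]]]].
split; [exact hy|].
apply Z.ltb_lt, IZR_lt in K; rewrite (second_bound_spec _ _ _ _ _ hd) in K.
assert (hD : 0 < IZR d) by (apply IZR_lt; auto).
assert (hB : 0 < IZR b) by (apply IZR_lt; auto).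
pose proof (second_mono beta (IZR alpha) (IZR b / IZR d) (branch (IZR a / IZR d))
  (IZR (b + 1) / IZR d) (IZR a / IZR d) (proj1 hy) ltac:(apply Rdiv_lt_0_compat; auto)
  ltac:(lra) ltac:(lra) ltac:(lra)) as [_ M].
unfold second; eapply Rle_lt_trans; [exact M|].
pose proof (pow_lt _ 133 hD).
apply (Rmult_lt_reg_l (31 * IZR d ^ 133)); [lra|rewrite Rmult_0_r; exact K].
Qed.

Lemma second_pos (a b d alpha : Z) (beta : R) :
  branch_check a b d = true ->
  Z.ltb 0 (second_bound a (b + 1) b d alpha) = true ->
  0 <= IZR alpha <= beta ->
  on_branch (IZR a / IZR d) /\ 0 < second beta (IZR a / IZR d).
Proof.
intros H K hb; destruct (branch_check_spec _ _ _ H) as [ha [hb' [hd [hy [hl hu]]]]].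
split; [exact hy|].
apply Z.ltb_lt, IZR_lt in K; rewrite (second_bound_spec _ _ _ _ _ hd) in K.
assert (hD : 0 < IZR d) by (apply IZR_lt; auto).
assert (hB : 0 < IZR b) by (apply IZR_lt; auto).
pose proof (second_mono (IZR alpha) beta (IZR b / IZR d) (branch (IZR a / IZR d))
  (IZR (b + 1) / IZR d) (IZR a / IZR d) (proj1 hy) ltac:(apply Rdiv_lt_0_compat; auto)
  ltac:(lra) ltac:(lra) ltac:(lra)) as [M _].
unfold second; eapply Rlt_le_trans; [|exact M].
pose proof (pow_lt _ 133 hD).
apply (Rmult_lt_reg_l (31 * IZR d ^ 133)); [lra|rewrite Rmult_0_r; exact K].
Qed.

(* Rational approximations of critical points of [parameter], except for the
   first one; they also separate the five roots of the system with
   [alpha = 0]. *)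
Definition haas_points : list R :=
  83 / 100 :: 8177 / 10000 :: 7542 / 10000 :: 7356 / 10000 :: 7108 / 10000 ::
  5213067 / 10000000 :: nil.

(** Positive signs are certified at parameter 0 and negative ones at 1936838, so the same points
    serve the explicit system and the case [alpha = 0]. *)
Lemma haas_points_alternate (alpha : R) : 0 <= alpha <= 1936838 ->
  Forall on_branch haas_points /\ alternates (second alpha) haas_points.
Proof.
intro h; unfold haas_points.
assert (P1 : on_branch (8300000 / 10000000) /\ 0 < second alpha (8300000 / 10000000))
  by (apply (second_pos 8300000 5139563 10000000 0);
      [vm_cast_no_check (eq_refl true)|vm_cast_no_check (eq_refl true)|lra]).
assert (P2 : on_branch (8177000 / 10000000) /\ second alpha (8177000 / 10000000) < 0)
  by (apply (second_neg 8177000 5888270 10000000 1936838);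
      [vm_cast_no_check (eq_refl true)|vm_cast_no_check (eq_refl true)|lra]).
assert (P3 : on_branch (7542000 / 10000000) /\ 0 < second alpha (7542000 / 10000000))
  by (apply (second_pos 7542000 7250607 10000000 0);
      [vm_cast_no_check (eq_refl true)|vm_cast_no_check (eq_refl true)|lra]).
assert (P4 : on_branch (7356000 / 10000000) /\ second alpha (7356000 / 10000000) < 0)
  by (apply (second_neg 7356000 7447565 10000000 1936838);
      [vm_cast_no_check (eq_refl true)|vm_cast_no_check (eq_refl true)|lra]).
assert (P5 : on_branch (7108000 / 10000000) /\ 0 < second alpha (7108000 / 10000000))
  by (apply (second_pos 7108000 7654100 10000000 0);
      [vm_cast_no_check (eq_refl true)|vm_cast_no_check (eq_refl true)|lra]).
(* The finer denominator tightens the enclosure of [branch]: the terms in the numerator of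
   [parameter] nearly cancel here, which magnifies the error in [x]. *)
assert (P6 : on_branch (52130670000 / 100000000000) /\ second alpha (52130670000 / 100000000000) < 0)
  by (apply (second_neg 52130670000 82713432643 100000000000 1936838);
      [vm_cast_no_check (eq_refl true)|vm_cast_no_check (eq_refl true)|lra]).
replace (8300000 / 10000000) with (83 / 100) in P1 by field.
replace (8177000 / 10000000) with (8177 / 10000) in P2 by field.
replace (7542000 / 10000000) with (7542 / 10000) in P3 by field.
replace (7356000 / 10000000) with (7356 / 10000) in P4 by field.
replace (7108000 / 10000000) with (7108 / 10000) in P5 by field.
replace (52130670000 / 100000000000) with (5213067 / 10000000) in P6 by field.
split; [repeat (apply Forall_cons; [tauto|]); apply Forall_nil|].
simpl; repeat split; try lra; nra.
Qed.

(** This is where the range of [alpha] enters: [parameter] is below 1936254 at the seventh point and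
    above 1936838 at its two neighbours. Eight points give seven sign changes. *)
Lemma root_points_alternate (alpha : R) : 1936254 <= alpha <= 1936838 ->
  Forall on_branch (haas_points ++ 5128584 / 10000000 :: 1 / 2 :: nil) /\
  alternates (second alpha) (haas_points ++ 5128584 / 10000000 :: 1 / 2 :: nil).
Proof.
intro h; destruct (haas_points_alternate alpha ltac:(lra)) as [F A].
assert (P7 : on_branch (51285840000 / 100000000000) /\ 0 < second alpha (51285840000 / 100000000000))
  by (apply (second_pos 51285840000 82763736142 100000000000 1936254);
      [vm_cast_no_check (eq_refl true)|vm_cast_no_check (eq_refl true)|lra]).
assert (P8 : on_branch (5000000 / 10000000) /\ second alpha (5000000 / 10000000) < 0)
  by (apply (second_neg 5000000 8281450 10000000 1936838);
      [vm_cast_no_check (eq_refl true)|vm_cast_no_check (eq_refl true)|lra]).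
assert (P6 : on_branch (52130670000 / 100000000000) /\ second alpha (52130670000 / 100000000000) < 0)
  by (apply (second_neg 52130670000 82713432643 100000000000 1936838);
      [vm_cast_no_check (eq_refl true)|vm_cast_no_check (eq_refl true)|lra]).
replace (51285840000 / 100000000000) with (5128584 / 10000000) in P7 by field.
replace (52130670000 / 100000000000) with (5213067 / 10000000) in P6 by field.
replace (5000000 / 10000000) with (1 / 2) in P8 by field.
split.
- apply Forall_app; split; [exact F|repeat (apply Forall_cons; [tauto|]); apply Forall_nil].
- simpl in A |- *; repeat split; try tauto; try lra; nra.
Qed.

Lemma seven_roots (alpha : R) : 1936254 <= alpha <= 1936838 ->
  has_exactly 7
    (positive_roots
      (fun x y => x ^ 6 + 44 / 31 * y ^ 3 - y)
      (fun x y => y ^ 14 + 44 / 31 * x ^ 3 * y ^ 8 - x * y ^ 8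
                  + alpha * x ^ 133)).
Proof.
intro h; destruct (root_points_alternate alpha h) as [F A].
assert (C : forall y, on_branch y -> continuity_pt (second alpha) y).
{ intros y hy; assert (H1 := branch_derive y hy).
  apply derivable_continuous_pt, ex_derive_Reals_0; unfold second.
  auto_derive; repeat split; eexists; eassumption. }
unfold haas_points in F, A; simpl app in F, A.
destruct (alternates_roots _ _ _ _ on_branch_convex C F A) as [l [Hl [S [_ I]]]].
pose proof (StronglySorted_Rgt_NoDup l S) as N.
assert (E : forall y, on_branch y -> second alpha y = 0 <-> parameter y = alpha).
{ intros y hy; unfold second, parameter; pose proof (pow_lt _ 133 (branch_pos y)) as hp.
  revert hp; generalize (branch y ^ 133); intros W hp.
  split; intro K.
  - apply (Rmult_eq_reg_r W); [|lra].
    unfold Rdiv; rewrite Rmult_assoc, Rinv_l by lra; lra.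
  - rewrite <- K; field; lra. }
exists (map (fun y => (branch y, y)) l); split; [|split].
- apply FinFun.Injective_map_NoDup; [|exact N].
  intros y z Hyz; injection Hyz; auto.
- rewrite length_map, Hl; reflexivity.
- intros [x y]; rewrite in_map_iff; split.
  + intros [z [Hz Iz]]; injection Hz as <- <-.
    destruct (I z Iz) as [hz Z]; pose proof (branch_pow6 z hz) as h6.
    unfold cubic in h6; unfold second in Z.
    split; [apply branch_pos|split; [apply hz|split; lra]].
  + intros [hx [hy [E1 E2]]].
    assert (h6 : x ^ 6 = cubic y) by (unfold cubic; lra).
    assert (ob : on_branch y) by (apply on_branch_cubic; [auto|rewrite <- h6; apply pow_lt; auto]).
    pose proof (branch_unique x y hx h6) as ->.
    exists y; split; [reflexivity|].
    (* A root outside [l] would be an eighth one. *)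
    destruct (in_dec Req_EM_T y l) as [i|i]; [exact i|exfalso].
    pose proof (parameter_at_most_7 alpha (y :: l)) as M.
    simpl length in M; rewrite Hl in M; simpl in M.
    cut (8 <= 7)%nat; [lia|]; apply M; [constructor; auto|].
    intros z [<-|Iz]; [split; [auto|]|destruct (I z Iz); split; [auto|]];
      apply E; auto.
Qed.

(** * The inductive construction *)

(* [x = X Y] and [y = X^2 Y] turn [x^6 / y], [y^2], [y^6 / x] and [x^2] into
   [X^4 Y^5], [X^4 Y^2], [X^11 Y^5] and [X^2 Y^2]: dividing the system by
   monomials then creates no negative exponents. *)
Definition coord1 (y : R) : R := y / branch y.
Definition coord2 (y : R) : R := branch y ^ 2 / y.

Lemma coord1_pos (y : R) : on_branch y -> 0 < coord1 y.
Proof. intros [h _]; apply Rdiv_lt_0_compat; [auto|apply branch_pos]. Qed.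

Lemma coord2_pos (y : R) : on_branch y -> 0 < coord2 y.
Proof. intros [h _]; apply Rdiv_lt_0_compat; [apply pow_lt, branch_pos|auto]. Qed.

Lemma coord_45 (y : R) : on_branch y -> coord1 y ^ 4 * coord2 y ^ 5 = 1 - 44 / 31 * y ^ 2.
Proof.
intro h; pose proof (branch_pow6 y h) as h6; pose proof (branch_pos y); destruct h as [h _].
unfold coord1, coord2, cubic in *.
transitivity (branch y ^ 6 / y); [field; lra|rewrite h6; field; lra].
Qed.

Lemma coord_42 (y : R) : on_branch y -> coord1 y ^ 4 * coord2 y ^ 2 = y ^ 2.
Proof.
intro h; pose proof (branch_pos y); destruct h as [h _].
unfold coord1, coord2; field; lra.
Qed.

Definition along (m : nat) (beta : nat -> R) (c d : nat -> nat) (y : R) : R :=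
  m_nomial m beta c d (coord1 y) (coord2 y).

Lemma coord_continuous (y : R) : on_branch y ->
  continuity_pt coord1 y /\ continuity_pt coord2 y.
Proof.
intro h; assert (H1 := branch_derive y h); pose proof (branch_pos y); destruct h as [h _].
split; apply derivable_continuous_pt, ex_derive_Reals_0; unfold coord1, coord2;
  auto_derive; repeat split; try (eexists; eassumption); lra.
Qed.

Lemma continuity_pt_sum (F : nat -> R -> R) (n : nat) (y : R) :
  (forall k, continuity_pt (F k) y) ->
  continuity_pt (fun z => sum_f_R0 (fun k => F k z) n) y.
Proof.
intro H; induction n as [|n IH]; [apply H|].
apply (continuity_pt_plus (fun z => sum_f_R0 (fun k => F k z) n) (F (S n))); auto.
Qed.

Lemma continuity_pt_pow (f : R -> R) (n : nat) (y : R) :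
  continuity_pt f y -> continuity_pt (fun z => f z ^ n) y.
Proof.
intro H; induction n as [|n IH].
- apply (continuity_pt_const (fun _ => 1)); intros ? ?; reflexivity.
- apply (continuity_pt_mult f (fun z => f z ^ n)); auto.
Qed.

Lemma along_continuous (m : nat) (beta : nat -> R) (c d : nat -> nat) (y : R) :
  on_branch y -> continuity_pt (along m beta c d) y.
Proof.
intro h; destruct (coord_continuous y h) as [C1 C2].
unfold along, m_nomial, sum_f.
apply (continuity_pt_plus (fun _ => beta 1%nat)).
- apply continuity_pt_const; intros ? ?; reflexivity.
- apply (continuity_pt_sum (fun k z =>
    beta (k + 2)%nat * coord1 z ^ c (k + 2)%nat * coord2 z ^ d (k + 2)%nat)).
  intro k.
  apply (continuity_pt_mult (fun z => beta (k + 2)%nat * coord1 z ^ c (k + 2)%nat));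
    [|apply continuity_pt_pow; auto].
  apply (continuity_pt_mult (fun _ => beta (k + 2)%nat));
    [|apply continuity_pt_pow; auto].
  apply continuity_pt_const; intros ? ?; reflexivity.
Qed.

(** * Appending a monomial to the second equation *)

Definition update (A : Type) (f : nat -> A) (m : nat) (v : A) (j : nat) : A :=
  if Nat.eqb j m then v else f j.

Lemma m_nomial_update (m : nat) (beta : nat -> R) (c d : nat -> nat) (b : R)
  (c' d' : nat) (x y : R) : (2 <= m)%nat ->
  m_nomial (S m) (update R beta (S m) b) (update nat c (S m) c') (update nat d (S m) d') x y =
  m_nomial m beta c d x y + b * x ^ c' * y ^ d'.
Proof.
intro hm; unfold m_nomial, sum_f.
(* The sum from 2 to [m] is stored with indices [0 .. m - 2] shifted by 2; for [2 <= m] the new term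
   is exactly one further summand. *)
replace (S m - 2)%nat with (S (m - 2)) by lia.
rewrite tech5; unfold update at 1.
replace (Nat.eqb 1 (S m)) with false by (symmetry; apply Nat.eqb_neq; lia).
replace (S (m - 2) + 2)%nat with (S m) by lia.
unfold update at 4 5 6; rewrite Nat.eqb_refl.
rewrite Rplus_assoc; f_equal; f_equal.
apply sum_eq; intros i hi; unfold update.
replace (Nat.eqb (i + 2) (S m)) with false by (symmetry; apply Nat.eqb_neq; lia).
reflexivity.
Qed.

Lemma exponent_vectors_update (a2 b2 a3 b3 m : nat) (c d : nat -> nat) (c' d' : nat) :
  (2 <= m)%nat ->
  exponent_vectors a2 b2 a3 b3 (S m) (update nat c (S m) c') (update nat d (S m) d') =
  exponent_vectors a2 b2 a3 b3 m c d ++ (c', d') :: nil.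
Proof.
intro hm; unfold exponent_vectors; simpl app; do 2 f_equal.
replace (S m - 1)%nat with (S (m - 1)) by lia.
rewrite seq_S, map_app; f_equal.
- apply map_ext_in; intros j hj; apply in_seq in hj; unfold update.
  replace (Nat.eqb j (S m)) with false by (symmetry; apply Nat.eqb_neq; lia); reflexivity.
- simpl; unfold update; replace (S (S (m - 1))) with (S m) by lia.
  rewrite Nat.eqb_refl; reflexivity.
Qed.

(** * Bumps concentrating at rational points *)

Lemma exp_pow_nat (x : R) (n : nat) : exp x ^ n = exp (INR n * x).
Proof.
induction n as [|n IH]; [simpl; rewrite Rmult_0_l, exp_0; reflexivity|].
rewrite S_INR; simpl; rewrite IH, <- exp_plus; f_equal; ring.
Qed.

Lemma exp_ineq (z : R) : z <= exp (z - 1).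
Proof.
destruct (Req_dec z 1) as [->|H]; [rewrite Rminus_diag, exp_0; lra|].
pose proof (exp_ineq1 (z - 1) ltac:(lra)); lra.
Qed.

(* Weighted AM-GM, through [z <= exp (z - 1)] applied to the two ratios. *)
Lemma bernstein_max (i j : nat) (u : R) : (1 <= i)%nat -> (1 <= j)%nat ->
  let v := INR i / INR (i + j) in
  0 < u < 1 -> u <> v -> u ^ i * (1 - u) ^ j < v ^ i * (1 - v) ^ j.
Proof.
intros hi hj v hu huv.
assert (Hi : 0 < INR i) by (apply lt_0_INR; lia).
assert (Hj : 0 < INR j) by (apply lt_0_INR; lia).
assert (Hv : v = INR i / (INR i + INR j)) by (unfold v; rewrite plus_INR; reflexivity).
assert (hv : 0 < v) by (rewrite Hv; apply Rdiv_lt_0_compat; lra).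
assert (Hw : 1 - v = INR j / (INR i + INR j)) by (rewrite Hv; field; lra).
assert (hw : 0 < 1 - v) by (rewrite Hw; apply Rdiv_lt_0_compat; lra).
set (p := u / v); set (q := (1 - u) / (1 - v)).
assert (hp : 0 < p) by (apply Rdiv_lt_0_compat; lra).
assert (hq : 0 < q) by (apply Rdiv_lt_0_compat; lra).
(* The exponents cancel, so the product of the two exponential bounds is [exp 0 = 1]. *)
assert (E : INR i * (p - 1) + INR j * (q - 1) = 0).
{ unfold p, q; rewrite Hw, Hv; field; lra. }
assert (p1 : p <> 1).
{ unfold p; intro K; apply huv; apply (f_equal (fun z => z * v)) in K.
  unfold Rdiv in K; rewrite Rmult_assoc, Rinv_l in K; lra. }
assert (Lp : p ^ i < exp (p - 1) ^ i).
{ pose proof (exp_ineq1 (p - 1) ltac:(lra)) as K.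
  destruct i as [|i]; [lia|].
  pose proof (pow_incr p (exp (p - 1)) i ltac:(lra)).
  pose proof (pow_lt p i hp); simpl; nra. }
assert (Lq : q ^ j <= exp (q - 1) ^ j).
{ apply pow_incr; split; [lra|apply exp_ineq]. }
assert (L : p ^ i * q ^ j < 1).
{ rewrite <- exp_0, <- E, exp_plus, <- !exp_pow_nat.
  pose proof (pow_lt _ j hq); pose proof (pow_lt _ i (exp_pos (p - 1))); nra. }
replace u with (p * v) at 1 by (unfold p; field; lra).
replace (1 - u) with (q * (1 - v)) by (unfold q; field; lra).
rewrite !Rpow_mult_distr.
pose proof (pow_lt _ i hv); pose proof (pow_lt _ j hw).
assert (0 < v ^ i * (1 - v) ^ j) by (apply Rmult_lt_0_compat; auto).
nra.
Qed.

(** For an integer [N > 1 / (b - a)], the first integer [k] above [a N] satisfies [a < k / N < b].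
    Then [i = k] and [j = N - k] are positive because [0 < a] and [b < 1]. *)
Lemma rational_between (a b : R) : 0 < a -> a < b -> b < 1 ->
  exists i j : nat, (1 <= i)%nat /\ (1 <= j)%nat /\ a < INR i / INR (i + j) < b.
Proof.
intros ha hab hb.
destruct (archimed (/ (b - a))) as [hN _].
set (N := up (/ (b - a))) in *.
assert (h0 : 0 < / (b - a)) by (apply Rinv_0_lt_compat; lra).
assert (hN1 : 1 < IZR N * (b - a)).
{ apply (Rmult_lt_compat_r (b - a)) in hN; [rewrite Rinv_l in hN; lra|lra]. }
destruct (archimed (a * IZR N)) as [k1 k2].
set (k := up (a * IZR N)) in *.
assert (N0 : 0 < IZR N) by lra.
assert (k0 : 0 < IZR k) by nra.
assert (kb : IZR k < b * IZR N) by nra.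
assert (kN : IZR k < IZR N) by nra.
apply lt_IZR in k0; apply lt_IZR in kN.
exists (Z.to_nat k), (Z.to_nat (N - k)).
split; [lia|split; [lia|]].
rewrite <- Z2Nat.inj_add by lia.
rewrite !INR_IZR_INZ, !Z2Nat.id by lia.
replace (k + (N - k))%Z with N by lia.
split; apply (Rmult_lt_reg_r (IZR N)); auto; unfold Rdiv;
  rewrite Rmult_assoc, Rinv_l; lra.
Qed.

Lemma pow_small_on_list (r : R -> R) (l : list R) (eps : R) : 0 < eps ->
  (forall y, In y l -> 0 <= r y < 1) ->
  exists N, forall M, (N <= M)%nat -> forall y, In y l -> r y ^ M < eps.
Proof.
intro he; induction l as [|a l IH]; intro H; [exists 0%nat; contradiction|].
destruct IH as [N1 H1]; [intros; apply H; right; auto|].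
destruct (H a (or_introl eq_refl)) as [ha ha'].
destruct (pow_lt_1_zero (r a) ltac:(rewrite Rabs_right; lra) eps he) as [N2 H2].
exists (Nat.max N1 N2); intros M hM y [<-|hy].
- pose proof (H2 M ltac:(lia)) as K; rewrite Rabs_right in K; [auto|].
  apply Rle_ge, pow_le; auto.
- apply H1; [lia|auto].
Qed.

(** Allows a new exponent vector to differ from all earlier ones through its first coordinate
    alone. *)
Lemma fst_bounded (l : list (nat * nat)) : exists K, forall a b, In (a, b) l -> (a <= K)%nat.
Proof.
induction l as [|[a b] l [K H]]; [exists 0%nat; contradiction|].
exists (Nat.max a K); intros a' b' [E|h]; [injection E; lia|].
apply H in h; lia.
Qed.

Lemma same_sign_right (f : R -> R) (t : R) : on_branch t -> continuity_pt f t ->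
  f t <> 0 ->
  exists r, t < r /\ on_branch r /\ forall y, t <= y <= r -> 0 < f t * f y.
Proof.
intros [h h'] C H.
destruct (C (Rabs (f t)) (Rabs_pos_lt _ H)) as [e [he K]].
(* As [t < 1] and [s <= 1], passing from [t] to [t + s] raises [44 t^2] by less than [132 s], so the
   last bound keeps [t + s] on the branch; [e / 2] stays within the continuity radius. *)
set (s := Rmin (e / 2) (Rmin 1 ((31 - 44 * t ^ 2) / 140))).
assert (s0 : 0 < s).
{ unfold s; repeat apply Rmin_glb_lt; lra. }
assert (s1 : s <= e / 2) by apply Rmin_l.
assert (s2 : s <= 1) by (eapply Rle_trans; [apply Rmin_r|apply Rmin_l]).
assert (s3 : s <= (31 - 44 * t ^ 2) / 140) by (eapply Rle_trans; [apply Rmin_r|apply Rmin_r]).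
exists (t + s); split; [lra|split; [split; nra|]].
intros y hy; destruct (Req_dec y t) as [->|ne].
- assert (f t * f t <> 0) by (apply Rmult_integral_contrapositive; auto); nra.
- apply same_sign_near; apply (K y); split; [split; [exact I|auto]|].
  simpl; unfold R_dist; rewrite Rabs_right; lra.
Qed.

(** * Induction on the number of terms *)

(** The induction carries [2 m] alternating sample points instead of [2 m - 1] roots, because
    alternation survives small perturbations. The largest point [t] is singled out since the new
    sign changes are created beyond it. *)
Definition oscillating (m : nat) : Prop :=
  exists (beta : nat -> R) (c d : nat -> nat),
    (forall j, (1 <= j <= m)%nat -> beta j <> 0) /\
    NoDup (exponent_vectors 4 5 4 2 m c d) /\
    ~ In (0, 0)%nat (exponent_vectors 4 5 4 2 m c d) /\
    exists t l, length l = (2 * m - 1)%nat /\ Forall on_branch (t :: l) /\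
      alternates (along m beta c d) (t :: l).

Lemma oscillating_3 : oscillating 3.
Proof.
set (beta := fun j : nat => match j with 1%nat => -1 | 2%nat => 44 / 31 | _ => 1 end).
set (c := fun j : nat => match j with 2%nat => 2%nat | _ => 11%nat end).
set (d := fun j : nat => match j with 2%nat => 2%nat | _ => 5%nat end).
exists beta, c, d; split; [|split; [|split]].
- intros [|[|[|j]]] hj; simpl; lra || lia.
- unfold exponent_vectors; simpl.
  repeat constructor; simpl; intuition congruence.
- unfold exponent_vectors; simpl; intuition congruence.
- destruct (haas_points_alternate 0 ltac:(lra)) as [F A].
  unfold haas_points in F, A.
  do 2 eexists; split; [|split; [exact F|]]; [reflexivity|].
  refine (alternates_ext_sign _ _ _ _ A).
  intros y hy.
  destruct (alternates_stable _ _ A ltac:(simpl; lia)) as [e [he K]].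
  pose proof (K (second 0) ltac:(intros; rewrite Rminus_diag, Rabs_R0; auto) y hy) as nz.
  assert (h : on_branch y) by (rewrite Forall_forall in F; auto).
  (* Division by [x y^8] leaves [-1 + 44/31 x^2 + y^6 / x]. *)
  assert (E : second 0 y = branch y * y ^ 8 * along 3 beta c d y).
  { unfold along, m_nomial, sum_f, second, coord1, coord2; simpl sum_f_R0; simpl beta; simpl c; simpl d.
    pose proof (branch_pos y); destruct h as [h _]; field; lra. }
  assert (k : 0 < branch y * y ^ 8).
  { apply Rmult_lt_0_compat; [apply branch_pos|apply pow_lt, h]. }
  rewrite E in nz |- *.
  set (a := along 3 beta c d y) in *; set (b := branch y * y ^ 8) in *.
  assert (0 < b * (a * a)) by (apply (Rmult_lt_reg_l b); [auto|]; lra).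
  lra.
Qed.

Lemma oscillating_S (m : nat) : (2 <= m)%nat -> oscillating m -> oscillating (S m).
Proof.
intros hm [beta [c [d [Hb [HN [H0 [t [l [Hl [F A]]]]]]]]]].
set (f := along m beta c d) in *.
destruct (alternates_stable f (t :: l) A ltac:(simpl; lia)) as [e [he K]].
assert (ht : on_branch t) by (inversion F; auto).
assert (ft : f t <> 0).
{ pose proof (K f ltac:(intros; rewrite Rminus_diag, Rabs_R0; auto) t (or_introl eq_refl)).
  intro E; rewrite E in H; lra. }
destruct (same_sign_right f t ht (along_continuous m beta c d t ht) ft) as [r [tr [hr sr]]].
assert (fr : f r <> 0).
{ pose proof (sr r ltac:(lra)); intro E; rewrite E in H; lra. }
(* In the coordinate [u = 44/31 y^2] the bump is to peak at a rational [v] between the values at [t]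
   and [r]; [p] is the corresponding [y]. *)
destruct (rational_between (44 / 31 * t ^ 2) (44 / 31 * r ^ 2)) as [i [j [hi [hj hv]]]].
{ destruct ht; nra. }
{ destruct ht; nra. }
{ destruct hr; nra. }
set (v := INR i / INR (i + j)) in *.
set (p := sqrt (31 / 44 * v)).
assert (hv0 : 0 < v) by (destruct ht; nra).
assert (p2 : p ^ 2 = 31 / 44 * v) by (unfold p; rewrite pow2_sqrt; lra).
assert (p0 : 0 < p) by (apply sqrt_lt_R0; lra).
assert (tp : t < p) by (destruct ht; nra).
assert (pr : p < r) by (destruct hr; nra).
assert (hp : on_branch p) by (apply (on_branch_convex t p r); auto; lra).
assert (fp : 0 < f t * f p) by (apply sr; lra).
assert (fp0 : f p <> 0) by (intro E; rewrite E in fp; lra).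
(* The exponent vector is [i (4, 2) + j (4, 5)], so on the branch [w] is a constant times
   [u^i (1 - u)^j], with its only maximum at [p]. *)
set (w := fun y => coord1 y ^ (4 * (i + j)) * coord2 y ^ (2 * i + 5 * j)).
assert (wE : forall y, on_branch y ->
  w y = (31 / 44) ^ i * ((44 / 31 * y ^ 2) ^ i * (1 - 44 / 31 * y ^ 2) ^ j)).
{ intros y hy; unfold w; rewrite <- (coord_45 y hy).
  rewrite <- Rmult_assoc, <- Rpow_mult_distr.
  replace (31 / 44 * (44 / 31 * y ^ 2)) with (coord1 y ^ 4 * coord2 y ^ 2)
    by (rewrite (coord_42 y hy); field).
  rewrite !Rpow_mult_distr, <- !pow_mult, Nat.mul_add_distr_l, !pow_add; ring. }
assert (wpos : forall y, on_branch y -> 0 < w y).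
{ intros y hy; apply Rmult_lt_0_compat; apply pow_lt;
    [apply coord1_pos|apply coord2_pos]; auto. }
assert (wmax : forall y, on_branch y -> y <> p -> 0 <= w y / w p < 1).
{ intros y hy ne; pose proof (wpos y hy); pose proof (wpos p hp).
  split; [left; apply Rdiv_lt_0_compat; auto|].
  apply (Rmult_lt_reg_r (w p)); [auto|].
  unfold Rdiv; rewrite Rmult_assoc, Rinv_l, Rmult_1_r, Rmult_1_l by lra.
  rewrite (wE y hy), (wE p hp); apply Rmult_lt_compat_l; [apply pow_lt; lra|].
  replace (44 / 31 * p ^ 2) with v by (rewrite p2; field).
  apply bernstein_max; auto; fold v; destruct hy as [hy hy'].
  - split; nra.
  - intro E; apply ne; assert (y ^ 2 = p ^ 2) by lra; nra. }
pose proof (Rabs_pos_lt _ fp0) as afp; pose proof (Rabs_pos_lt _ fr) as afr.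
(* Chosen so that [2 |f p| eps] is the perturbation tolerated both at the old points and at [r]. *)
set (eps := Rmin e (Rabs (f r)) / (2 * Rabs (f p))).
assert (heps : 0 < eps) by (apply Rdiv_lt_0_compat; [apply Rmin_glb_lt; auto|lra]).
assert (below : forall y, In y (t :: l) -> y <= t).
{ intros y hy; exact (alternates_head_max f l t y A hy). }
destruct (pow_small_on_list (fun y => w y / w p) (r :: t :: l) eps heps) as [N1 HN1].
{ intros y [<-|hy]; [apply wmax; [auto|lra]|].
  apply wmax; [rewrite Forall_forall in F; auto|].
  apply below in hy; lra. }
destruct (fst_bounded (exponent_vectors 4 5 4 2 m c d)) as [N2 HN2].
(* [N1] makes the bump small at the other points, and [S N2] makes its first exponent exceed all
   earlier ones. *)
set (M := Nat.max N1 (S N2)).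
(* This coefficient turns the value [f p] into [- f p]. *)
set (b := - 2 * f p / w p ^ M).
assert (wpM : 0 < w p ^ M) by (apply pow_lt; auto).
set (c' := (4 * (i + j) * M)%nat); set (d' := ((2 * i + 5 * j) * M)%nat).
assert (big : (N2 < c')%nat) by (unfold c', M; nia).
exists (update R beta (S m) b), (update nat c (S m) c'), (update nat d (S m) d').
rewrite exponent_vectors_update by auto.
split; [|split; [|split]].
- intros k hk; unfold update; destruct (Nat.eqb k (S m)) eqn:E.
  + unfold b; apply Rmult_integral_contrapositive; split;
      [lra|apply Rinv_neq_0_compat; lra].
  + apply Hb; apply Nat.eqb_neq in E; lia.
- apply NoDup_app; auto.
  + repeat constructor; auto.
  + intros [x y] hx [E|[]]; injection E as <- <-; apply HN2 in hx; lia.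
- rewrite in_app_iff; intros [h|[E|[]]]; [auto|injection E; lia].
- set (g := along (S m) _ _ _).
  assert (gE : forall y, g y = f y + b * w y ^ M).
  { intro y; unfold g, f, along; rewrite m_nomial_update by auto.
    unfold w, c', d'; rewrite Rpow_mult_distr, <- !pow_mult; ring. }
  assert (gp : g p = - f p).
  { rewrite gE; unfold b; field; lra. }
  assert (small : forall y, In y (r :: t :: l) ->
    Rabs (g y - f y) < Rmin e (Rabs (f r))).
  { intros y hy; rewrite gE.
    replace (f y + b * w y ^ M - f y) with (- 2 * f p * (w y / w p) ^ M).
    - assert (hyb : on_branch y) by (destruct hy as [<-|hy]; [auto|rewrite Forall_forall in F; auto]).
      pose proof (HN1 M ltac:(unfold M; lia) y hy) as L.
      assert (0 < w y / w p) by (apply Rdiv_lt_0_compat; auto).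
      rewrite !Rabs_mult, (Rabs_left (-2)) by lra.
      rewrite (Rabs_right (_ ^ M)) by (apply Rle_ge, pow_le; lra).
      apply (Rmult_lt_compat_l (2 * Rabs (f p))) in L; [|lra].
      unfold eps in L.
      replace (2 * Rabs (f p) * (Rmin e (Rabs (f r)) / (2 * Rabs (f p))))
        with (Rmin e (Rabs (f r))) in L by (field; lra).
      lra.
    - unfold b, Rdiv; rewrite Rpow_mult_distr, pow_inv; ring. }
  assert (old : forall y, In y (t :: l) -> 0 < f y * g y).
  { apply K; intros y hy; eapply Rlt_le_trans; [apply small; right; auto|apply Rmin_l]. }
  assert (gr : 0 < f r * g r).
  { apply same_sign_near; eapply Rlt_le_trans; [apply small; left; auto|apply Rmin_r]. }
  (* The sign at [r] and [t] is that of [f t] and the sign at [p] is the opposite, which gives two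
     more sign changes. *)
  exists r, (p :: t :: l); split; [simpl; lia|split; [auto|]].
  split; [exact pr|split; [|split; [exact tp|split]]].
  + rewrite gp; pose proof (sr r ltac:(lra)) as h.
    assert (0 < g r * f p).
    { apply (same_sign_trans _ (f t)); [|auto].
      apply (same_sign_trans _ (f r)); lra. }
    lra.
  + rewrite gp; pose proof (old t (or_introl eq_refl)) as h.
    assert (0 < f p * g t) by (apply (same_sign_trans _ (f t)); lra).
    lra.
  + exact (alternates_ext_sign f g _ old A).
Qed.

Lemma oscillating_all (m : nat) : (3 <= m)%nat -> oscillating m.
Proof.
intro hm; induction hm as [|m hm IH]; [exact oscillating_3|].
apply oscillating_S; [lia|exact IH].
Qed.

Theorem theorem1 :
  (forall m : nat, (3 <= m)%nat ->
    exists (alpha1 alpha2 alpha3 : R) (a2 b2 a3 b3 : nat)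
           (beta : nat -> R) (c d : nat -> nat),
      (alpha1 <> 0 /\ alpha2 <> 0 /\ alpha3 <> 0) /\
      (forall j : nat, (1 <= j <= m)%nat -> beta j <> 0) /\
      NoDup (exponent_vectors a2 b2 a3 b3 m c d) /\
      ~ In (0%nat, 0%nat) (exponent_vectors a2 b2 a3 b3 m c d) /\
      has_at_least (2 * m - 1)
        (positive_roots (trinomial alpha1 alpha2 alpha3 a2 b2 a3 b3)
                        (m_nomial m beta c d)))
  /\
  (forall alpha : R, 1936254 <= alpha <= 1936838 ->
    has_exactly 7
      (positive_roots
        (fun x y => x ^ 6 + 44 / 31 * y ^ 3 - y)
        (fun x y => y ^ 14 + 44 / 31 * x ^ 3 * y ^ 8 - x * y ^ 8
                    + alpha * x ^ 133))).
Proof.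
split; [|exact seven_roots].
intros m hm.
destruct (oscillating_all m hm) as [beta [c [d [Hb [HN [H0 [t [l [Hl [F A]]]]]]]]]].
(* On the branch the first equation reads [-1 + (1 - u) + u = 0] with [u = 44/31 y^2]. *)
exists (-1), 1, (44 / 31), 4%nat, 5%nat, 4%nat, 2%nat, beta, c, d.
split; [lra|split; [exact Hb|split; [exact HN|split; [exact H0|]]]].
destruct (alternates_roots on_branch _ _ _ on_branch_convex
  (along_continuous m beta c d) F A) as [l' [Hl' [S' [_ I]]]].
exists (map (fun y => (coord1 y, coord2 y)) l'); split; [|split].
(* The coordinates determine [y > 0] through [coord1 y ^ 4 * coord2 y ^ 2 = y ^ 2]. *)
- apply FinFun.Injective_map_NoDup_in; [|apply StronglySorted_Rgt_NoDup; auto].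
  intros y z hy hz E; injection E as E1 E2.
  destruct (I y hy) as [by_ _]; destruct (I z hz) as [bz _].
  pose proof (coord_42 y by_) as Ey; rewrite E1, E2, (coord_42 z bz) in Ey.
  destruct by_, bz; nra.
- rewrite length_map, Hl', Hl; reflexivity.
- intros [x y] hp; apply in_map_iff in hp as [z [Hz Iz]]; injection Hz as <- <-.
  destruct (I z Iz) as [bz Z].
  split; [apply coord1_pos; auto|split; [apply coord2_pos; auto|split; [|exact Z]]].
  unfold trinomial; rewrite Rmult_1_l, Rmult_assoc, coord_45, coord_42 by auto; ring.
Qed.
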